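(* Let $G$ be a connected graph with $n\ge 2$ vertices and let $P$ be a price function on $G$. Then $\pi_{P}^{n-1}(G)+1=\pi_{P}^{n}(G)$.
   Context: A configuration of $k$ pebbles on a graph $G$ is a function $C:V(G)\to\mathbb{Z}_{\ge 0}$ with $\sum_{v}C(v)=k$. A price function is a function $P:V(G)\to\mathbb{Z}_{\ge 2}$, with value $p_v$ at $v$. A pebbling move along an edge $v_hv_k$ removes $p_{h}$ pebbles from $v_h$ and adds one pebble to $v_k$; it is allowed only if the result has no negative values. A configuration $C'$ is derivable from $C$ if it is obtained from $C$ by a finite sequence of pebbling moves. A configuration covers a set of vertices if it is nonzero at each of them. A configuration $C$ is $t$-solvable if for every set of $t$ vertices there is a configuration derivable from $C$ covering that set. For $1\le t\le n$, $\pi_P^t(G)$ is the minimum $k$ such that every configuration of $k$ pebbles on $G$ (with price function $P$) is $t$-solvable. *)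

(* Defs.v *)
From mathcomp Require Import all_boot.

Set Implicit Arguments.
Unset Strict Implicit.
Unset Printing Implicit Defensive.

(* A finite simple graph is a finType V of vertices with a symmetric,
   irreflexive adjacency relation e. *)
Definition simple_graph (V : finType) (e : rel V) : Prop :=
  symmetric e /\ irreflexive e.

Definition connected_graph (V : finType) (e : rel V) : Prop :=
  forall x y : V, connect e x y.

Definition price_function (V : finType) (P : V -> nat) : Prop :=
  forall v, 2 <= P v.

Definition config (V : finType) := {ffun V -> nat}.

Definition pebbles (V : finType) (C : config V) : nat := \sum_(v : V) C v.

(* The truncated subtraction is used under the guard P h <= C h of
   pebbling_move; h and k are distinct since they are adjacent. *)
Definition move (V : finType) (P : V -> nat) (C : config V) (h k : V) :
    config V :=
  [ffun v => if v == h then C h - P h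
             else if v == k then C k + 1 else C v].

Definition pebbling_move (V : finType) (e : rel V) (P : V -> nat) :
    rel (config V) :=
  fun C C' =>
    [exists h, exists k, [&& e h k, P h <= C h & C' == move P C h k]].

Definition derivable (V : finType) (e : rel V) (P : V -> nat)
    (C C' : config V) : Prop :=
  exists2 s : seq (config V), path (pebbling_move e P) C s & C' = last C s.

Definition covers (V : finType) (C : config V) (S : {set V}) : Prop :=
  forall v, v \in S -> C v <> 0.

Definition solvable (V : finType) (e : rel V) (P : V -> nat) (t : nat)
    (C : config V) : Prop :=
  forall S : {set V}, #|S| = t ->
    exists2 C' : config V, derivable e P C C' & covers C' S.

Definition all_solvable (V : finType) (e : rel V) (P : V -> nat)
    (t k : nat) : Prop :=
  forall C : config V, pebbles C = k -> solvable e P t C.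

(* is_pebbling_number e P t k says that pi_P^t(G) exists and equals k; such a
   k is unique, being the minimum of a set of natural numbers. *)
Definition is_pebbling_number (V : finType) (e : rel V) (P : V -> nat)
    (t k : nat) : Prop :=
  all_solvable e P t k /\ (forall k', all_solvable e P t k' -> k <= k').

(* Main.v *)
(** Adding and removing one pebble relates the two solvability conditions.

    From a configuration of [k + 1] pebbles, set one pebble of a vertex [v]
    aside, cover the other [n - 1] vertices with the remaining [k] pebbles, and
    put the pebble back on [v]: hence [pi^n <= pi^(n-1) + 1].

    Conversely, let [C] have [k] pebbles and add a pebble on the vertex [v] that
    need not be covered. If all vertices can be covered from there, record only
    how often each edge is used. In the final balance of [v] the added pebble is
    to spare, so the balance stays nonnegative without it. By the no-cycle lemma
    a system of moves with nonnegative balance can, after deleting directed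
    cycles of moves (which never lowers a balance), be carried out in some
    order; so [C] covers all vertices but [v]. *)

Require Import Defs.
From mathcomp Require Import all_boot zify.
From Stdlib Require Import Classical Wf_nat.

Set Implicit Arguments.
Unset Strict Implicit.
Unset Printing Implicit Defensive.

Section Pebbling.

Variables (V : finType) (e : rel V) (P : V -> nat).
Hypotheses (He : simple_graph e) (HP : price_function P).

Local Notation derivable := (derivable e P).

(** * Derivability and sums of configurations *)

Definition addc (C D : config V) : config V := [ffun v => C v + D v].

Definition stack (x : V) (m : nat) : config V := [ffun v => (v == x) * m].

Lemma edge_neq h k : e h k -> h != k.
Proof. by case: He => _ irr; apply: contraTneq => ->; rewrite irr. Qed.

Lemma derivable_refl (C : config V) : derivable C C.
Proof. by exists [::]. Qed.

Lemma derivable_trans D C E : derivable C D -> derivable D E -> derivable C E.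
Proof.
case=> s ps -> [t pt ->]; exists (s ++ t); last by rewrite last_cat.
by rewrite cat_path ps.
Qed.

Lemma derivable_move (C : config V) h k : e h k -> P h <= C h -> derivable C (move P C h k).
Proof.
move=> ehk Ph; exists [:: move P C h k] => //=; rewrite andbT.
by apply/existsP; exists h; apply/existsP; exists k; rewrite ehk Ph eqxx.
Qed.

Lemma derivable_ind_l (Q : config V -> config V -> Prop) :
  (forall C, Q C C) ->
  (forall (C D : config V) h k, e h k -> P h <= C h -> Q (move P C h k) D -> Q C D) ->
  forall C D, derivable C D -> Q C D.
Proof.
move=> Q0 QS C D [s]; elim: s C => [|C' s IHs] C /=; first by move=> _ ->.
case/andP=> /existsP[h /existsP[k /and3P[ehk Ph /eqP->]]] ps eD.
exact: QS ehk Ph (IHs _ ps eD).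
Qed.

Lemma move_addc (C E : config V) h k :
  P h <= C h -> move P (addc C E) h k = addc (move P C h k) E.
Proof.
move=> Ph; apply/ffunP=> v; rewrite !ffunE.
by have [->|_] := eqVneq v h; [|have [->|_] := eqVneq v k]; lia.
Qed.

Lemma derivable_addc E C D : derivable C D -> derivable (addc C E) (addc D E).
Proof.
move: C D; apply: derivable_ind_l => [C|C D h k ehk Ph]; first exact: derivable_refl.
apply: derivable_trans; rewrite -move_addc //.
by apply: derivable_move => //; rewrite ffunE; lia.
Qed.

Lemma derivable_addc2 C1 C2 D1 D2 :
  derivable C1 D1 -> derivable C2 D2 -> derivable (addc C1 C2) (addc D1 D2).
Proof.
have addcC A B : addc A B = addc B A by apply/ffunP=> v; rewrite !ffunE addnC.
move=> d1 d2; apply: derivable_trans (derivable_addc C2 d1) _.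
by rewrite addcC (addcC D1); apply: derivable_addc.
Qed.

Lemma addc_stack x m n : addc (stack x m) (stack x n) = stack x (m + n).
Proof. by apply/ffunP=> v; rewrite !ffunE mulnDr. Qed.

Lemma pebbles_addc_stack C v m : pebbles (addc C (stack v m)) = pebbles C + m.
Proof.
rewrite /pebbles (eq_bigr (fun w => C w + (w == v) * m)); last first.
  by move=> w _; rewrite !ffunE.
rewrite big_split /=; congr (_ + _).
by rewrite (bigD1 v) //= eqxx mul1n big1 ?addn0 // => w /negbTE->.
Qed.

(** * The no-cycle lemma *)

(* A flow [m] records the number [m x y] of moves along each edge [xy]. *)
Definition outflow (m : V -> V -> nat) v := \sum_y m v y.
Definition inflow (m : V -> V -> nat) v := \sum_x m x v.
Definition volume (m : V -> V -> nat) := \sum_x outflow m x.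

Definition on_edges (m : V -> V -> nat) := forall x y, 0 < m x y -> e x y.

Definition unit_flow (h k x y : V) : nat := (x == h) && (y == k).

Lemma outflow_unit h k v : outflow (unit_flow h k) v = (v == h).
Proof.
rewrite /outflow (bigD1 k) //= /unit_flow eqxx andbT big1 ?addn0 //.
by move=> y /negbTE->; rewrite andbF.
Qed.

Lemma inflow_unit h k v : inflow (unit_flow h k) v = (v == k).
Proof.
rewrite /inflow (bigD1 h) //= /unit_flow eqxx big1 ?addn0 //.
by move=> y /negbTE->.
Qed.

Lemma outflowD m d v :
  outflow (fun x y => m x y + d x y) v = outflow m v + outflow d v.
Proof. exact: big_split. Qed.

Lemma inflowD m d v :
  inflow (fun x y => m x y + d x y) v = inflow m v + inflow d v.
Proof. exact: big_split. Qed.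

Section Subflow.

Variables (m d : V -> V -> nat).
Hypothesis (le_dm : forall x y, d x y <= m x y).

Let r x y := m x y - d x y.

Lemma outflow_sub v : outflow m v = outflow r v + outflow d v.
Proof. by rewrite -outflowD; apply: eq_bigr => y _; rewrite subnK. Qed.

Lemma inflow_sub v : inflow m v = inflow r v + inflow d v.
Proof. by rewrite -inflowD; apply: eq_bigr => y _; rewrite subnK. Qed.

(** Volume is the measure on which the induction over flows runs. *)
Lemma volume_sub v : 0 < outflow d v -> volume r < volume m.
Proof.
move=> d_gt0; rewrite /volume [X in _ < X](eq_bigr _ (fun x _ => outflow_sub x)).
by rewrite big_split /= (bigD1 v (F := outflow d)) //=; lia.
Qed.

Lemma on_edges_sub : on_edges m -> on_edges r.
Proof. by move=> em x y r_gt0; apply: em; rewrite /r in r_gt0; lia. Qed.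

End Subflow.

(** The order of the moves is forgotten. The balance is stated additively to avoid truncated
    subtraction. *)
Lemma derivable_flow (C D : config V) : derivable C D ->
  exists2 m, on_edges m &
    forall v, D v + P v * outflow m v = C v + inflow m v.
Proof.
move: C D; apply: derivable_ind_l => [C|C D h k ehk Ph [m em bal]].
  exists (fun _ _ => 0) => // v.
  by rewrite /outflow /inflow !big1 ?muln0.
exists (fun x y => m x y + unit_flow h k x y) => [x y|v].
  rewrite /unit_flow; case: eqP => [->|_]; last by rewrite addn0 => /em.
  by case: eqP => [->|_] //; rewrite addn0 => /em.
rewrite outflowD inflowD outflow_unit inflow_unit mulnDr addnA bal ffunE.
have := edge_neq ehk; have [->|_] := eqVneq v h.
  by move=> /negbTE->; lia.
by have [->|_] := eqVneq v k; lia.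
Qed.

(* A minimal nonempty [f]-stable set is permuted by [f]: it is a cycle. *)
Lemma stable_cycle (f : V -> V) (A : {set V}) x :
  x \in A -> {in A, forall y, f y \in A} ->
  exists Y : {set V}, [/\ Y != set0, Y \subset A & f @: Y = Y].
Proof.
move=> xA fA; pose Q (Y : {set V}) := (Y != set0) && (f @: Y \subset Y).
have QA : Q A.
  apply/andP; split; first by apply/set0Pn; exists x.
  by apply/subsetP=> _ /imsetP[y yA ->]; apply: fA.
have [Y /minsetP[/andP[Y0 fY] minY] YA] := minset_exists QA.
(* The image of [Y] is again nonempty and stable, so minimality makes it all of [Y]. *)
exists Y; split=> //; apply: minY => //; rewrite /Q imsetS // andbT.
by case/set0Pn: Y0 => y yY; apply/set0Pn; exists (f y); apply: imset_f.
Qed.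

Section Cycle.

Variables (f : V -> V) (Y : {set V}).

(** Edges run from [f y] to [y], since [f] will select predecessors. *)
Definition cycle_flow (x y : V) : nat := (y \in Y) && (f y == x).

Lemma inflow_cycle v : inflow cycle_flow v = (v \in Y).
Proof.
rewrite /inflow (bigD1 (f v)) //= /cycle_flow eqxx andbT big1 ?addn0 //.
by move=> x /negbTE; rewrite eq_sym => ->; rewrite andbF.
Qed.

(** Being onto the finite set [Y], [f] is injective there, so each vertex of [Y] is the predecessor
    of exactly one other or of itself. *)
Lemma outflow_cycle v : f @: Y = Y -> outflow cycle_flow v = (v \in Y).
Proof.
move=> fY; have injf : {in Y &, injective f} by apply/imset_injP; rewrite fY.
rewrite /outflow /cycle_flow; case: (boolP (v \in Y)) => [|vY].
  rewrite -{1}fY => /imsetP[y yY ->]; rewrite (bigD1 y) //= yY eqxx big1 //.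
  move=> z; apply: contraNeq; rewrite eqb0 negbK => /andP[zY /eqP fzy].
  exact/eqP/injf.
rewrite big1 // => y _; apply/eqP; rewrite eqb0; apply: contra vY.
by case/andP=> yY /eqP<-; rewrite -fY imset_f.
Qed.

End Cycle.

(* Either some vertex can afford one of its recorded moves, which we carry out,
   or every vertex with an outgoing move also has an incoming one; following
   moves backwards then gives a cycle, which we delete from the flow. *)
Lemma flow_derivable (C : config V) m : on_edges m ->
  (forall v, P v * outflow m v <= C v + inflow m v) ->
  exists2 D, derivable C D &
    forall v, C v + inflow m v <= D v + P v * outflow m v.
Proof.
have [N leN] := ubnP (volume m); elim: N => // N IHN in C m leN * => em bal.
have [/existsP[h /andP[m_gt0 Ph]]|] :=
  boolP [exists h, (0 < outflow m h) && (P h <= C h)].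
  have [k mhk] : exists k, 0 < m h k.
    apply/existsP; apply: contraTT m_gt0; rewrite negb_exists => /forallP m0.
    by rewrite -eqn0Ngt /outflow big1 // => y _; have := m0 y; lia.
  have ehk := em _ _ mhk; have hk := edge_neq ehk.
  have le_m x y : unit_flow h k x y <= m x y.
    by rewrite /unit_flow; case: eqP => // ->; case: eqP => // ->.
  have balE v : [/\ outflow m v = _ & inflow m v = _] :=
    conj (outflow_sub le_m v) (inflow_sub le_m v).
  have [||v|D CD DE] := IHN (move P C h k) (fun x y => m x y - unit_flow h k x y).
  - have := @volume_sub _ _ le_m h; rewrite outflow_unit eqxx => /(_ isT); lia.
  - exact: on_edges_sub.
  - move: (bal v); have [-> ->] := balE v; rewrite outflow_unit inflow_unit ffunE.
    have [->|_] := eqVneq v h; first by rewrite (negbTE hk); lia.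
    by have [->|_] := eqVneq v k; lia.
  exists D; first exact: derivable_trans (derivable_move ehk Ph) CD.
  move=> v; move: (DE v); have [-> ->] := balE v.
  rewrite outflow_unit inflow_unit ffunE.
  have [->|_] := eqVneq v h; first by rewrite (negbTE hk); lia.
  by have [->|_] := eqVneq v k; lia.
rewrite negb_exists => /forallP stuck.
pose A := [set v | 0 < outflow m v].
have [A0|[x xA]] := set_0Vmem A.
  (* No vertex has an outgoing move, so the flow is zero and [C] itself serves. *)
  exists C => [|v]; first exact: derivable_refl.
  have inm : inflow m v = 0.
    rewrite /inflow big1 // => x _; apply/eqP; rewrite eqn0Ngt.
    apply/negP => mxv; have /negP[] : x \notin A by rewrite A0 inE.
    by rewrite inE /outflow (bigD1 v) //=; lia.
  by rewrite inm; lia.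
have pred_ex v : exists u, v \in A -> 0 < m u v.
  case: (boolP (v \in A)) => [vA|_]; last by exists v.
  have /existsP[u mu] : [exists u, 0 < m u v]; last by exists u.
  apply: contraTT vA => /existsPn m0; rewrite inE.
  have in0 : inflow m v = 0 by rewrite /inflow big1 // => u _; have := m0 u; lia.
  (* Without inflow, the balance says that [C v] alone pays for a move out of [v], against
     [stuck]. *)
  by move: (stuck v) (bal v); rewrite in0; case: (outflow m v) => // n; nia.
have [f fP] := fin_all_exists pred_ex.
have fA : {in A, forall y, f y \in A}.
  by move=> y /fP; rewrite inE /outflow (bigD1 y) //=; lia.
have [Y [/set0Pn[y yY] YA fY]] := stable_cycle xA fA.
have le_m u v : cycle_flow f Y u v <= m u v.
  rewrite /cycle_flow; case: (boolP (v \in Y)) => //= vY.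
  by case: eqP => // <-; apply: fP; apply: (subsetP YA).
have balE v : [/\ outflow m v = _ & inflow m v = _] :=
  conj (outflow_sub le_m v) (inflow_sub le_m v).
have [||v|D CD DE] := IHN C (fun u v => m u v - cycle_flow f Y u v).
- have := @volume_sub _ _ le_m y; rewrite outflow_cycle // yY => /(_ isT); lia.
- exact: on_edges_sub.
(* A vertex of the cycle loses one incoming pebble but saves [P v], so its balance does not drop. *)
- move: (bal v) (HP v); have [-> ->] := balE v.
  by rewrite outflow_cycle // inflow_cycle; case: (v \in Y); lia.
exists D => // v; move: (DE v) (HP v); have [-> ->] := balE v.
by rewrite outflow_cycle // inflow_cycle; case: (v \in Y); lia.
Qed.

Lemma derivable_drop (C : config V) v (D : config V) :
  derivable (addc C (stack v 1)) D -> 0 < D v ->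
  exists2 D', derivable C D' & forall w, w != v -> D w <= D' w.
Proof.
move=> /derivable_flow[m em bal] Dv.
have {}bal w : D w + P w * outflow m w = C w + (w == v) + inflow m w.
  by rewrite bal !ffunE muln1.
(* At [v], [0 < D v] makes up for the missing pebble. *)
have Cbal w : P w * outflow m w <= C w + inflow m w.
  by have := bal w; have [->|_] := eqVneq w v; lia.
have [D' CD' D'E] := flow_derivable em Cbal.
exists D' => // w /negbTE wv; have := D'E w; have := bal w; rewrite wv; lia.
Qed.

(** * Existence of the pebbling numbers *)

Hypothesis (Hconn : connected_graph e).

Lemma stack_reach x y m : exists N, derivable (stack x N) (stack y m).
Proof.
have /connectP[p] := Hconn x y; elim: p x => [|z p IHp] x /=.
  by move=> _ ->; exists m; apply: derivable_refl.
case/andP=> exz pz yE; have [N zN] := IHp z pz yE.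
exists (N * P x); apply: derivable_trans zN.
elim: N => [|N IHN].
  have -> : stack x (0 * P x) = stack z 0.
    by apply/ffunP=> v; rewrite !ffunE !muln0.
  exact: derivable_refl.
(* A batch of [P x] pebbles is split off to buy one pebble on [z]. *)
rewrite mulSn -[N.+1]add1n -!addc_stack; apply: derivable_addc2 => //.
suff <- : move P (stack x (P x)) x z = stack z 1.
  by apply: derivable_move; rewrite // ffunE eqxx mul1n.
apply/ffunP=> v; rewrite !ffunE eqxx mul1n subnn.
have := edge_neq exz; have [->|_] := eqVneq v x; first by move/negbTE->.
by rewrite eq_sym => /negbTE->; have [_|_] := eqVneq v z.
Qed.

Lemma stack_covers x :
  exists N (D : config V), derivable (stack x N) D /\ forall v, 0 < D v.
Proof.
suff [N [D [xD Dpos]]] : exists N (D : config V), derivable (stack x N) D /\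
    {in enum V, forall v, 0 < D v}.
  by exists N, D; split=> // v; apply: Dpos; rewrite mem_enum.
elim: (enum V) => [|y s [N [D [xD Dpos]]]].
  by exists 0, (stack x 0); split=> //; apply: derivable_refl.
have [N' xy] := stack_reach x y 1.
exists (N' + N), (addc (stack y 1) D); split.
  by rewrite -addc_stack; apply: derivable_addc2.
move=> v; rewrite inE !ffunE muln1; case: eqP => //= _ /Dpos; lia.
Qed.

Lemma all_solvable_card_ex : exists k, all_solvable e P #|V| k.
Proof.
have [N NP] := fin_all_exists stack_covers.
(* By pigeonhole, some [x] then holds [N x] pebbles, enough to cover every vertex from [x] alone. *)
exists (\sum_v N v).+1 => C pC S _.
have [x leNx] : exists x, N x <= C x.
  apply/existsP; move: pC; apply: contra_eqT => /existsPn ltCN.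
  suff : pebbles C <= \sum_v N v by lia.
  by apply: leq_sum => v _; have := ltCN v; lia.
have [D [xD Dpos]] := NP x.
pose E : config V := [ffun v => C v - stack x (N x) v].
have CE : C = addc (stack x (N x)) E.
  apply/ffunP=> v; rewrite !ffunE; case: eqVneq => [->|_]; lia.
exists (addc D E); first by rewrite {1}CE; apply: derivable_addc.
by move=> v _; rewrite ffunE; have := Dpos v; lia.
Qed.

(** * Comparison of the two solvability conditions *)

Lemma all_solvable_cardS k :
  all_solvable e P #|V|.-1 k -> all_solvable e P #|V| k.+1.
Proof.
move=> solk C pC S _.
have [v Cv] : exists v, 0 < C v.
  apply/existsP; move: pC; apply: contra_eqT => /existsPn C0.
  by rewrite /pebbles big1 // => v _; have := C0 v; lia.
pose C' : config V := [ffun w => C w - stack v 1 w].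
have CE : C = addc C' (stack v 1).
  by apply/ffunP=> w; rewrite !ffunE; case: eqVneq => [->|_]; lia.
have pC' : pebbles C' = k by move: pC; rewrite CE pebbles_addc_stack; lia.
have [D C'D Dcov] := solk C' pC' [set~ v] (cardsC1 v).
exists (addc D (stack v 1)); first by rewrite CE; apply: derivable_addc.
move=> w _; rewrite !ffunE muln1; case: eqVneq => [->|wv]; first by lia.
by have := Dcov w; rewrite !inE => /(_ wv); lia.
Qed.

Lemma all_solvable_cardP k : 0 < #|V| ->
  all_solvable e P #|V| k.+1 -> all_solvable e P #|V|.-1 k.
Proof.
move=> V_gt0 solk C pC S cS.
(* The extra pebble goes on the only vertex outside [S]. *)
have /cards1P[v Sv] : #|~: S| == 1 by rewrite cardsCs setCK cS; lia.
have [|D CD Dcov] := solk (addc C (stack v 1)) _ setT (cardsT V).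
  by rewrite pebbles_addc_stack pC addn1.
have Dpos w : 0 < D w by have := Dcov w; rewrite inE => /(_ isT); lia.
have [D' CD' leD] := derivable_drop CD (Dpos v).
exists D' => // w wS; have wv : w != v.
  by apply: contraTneq wS => ->; rewrite -[v \in S]negbK -in_setC Sv inE eqxx.
by have := leD w wv; have := Dpos w; lia.
Qed.

(** The empty configuration allows no move, as prices are positive. Hence the minimum for all
    vertices is a successor [k.+1], and [k] is the witness for the theorem. *)
Lemma not_all_solvable0 : 0 < #|V| -> ~ all_solvable e P #|V| 0.
Proof.
move=> /card_gt0P[x _] sol0.
pose Z : config V := [ffun _ => 0].
have pZ : pebbles Z = 0 by rewrite /pebbles big1 // => v _; rewrite ffunE.
have [D] := sol0 Z pZ setT (cardsT V).
case=> -[|C' s] /= ps -> Dcov.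
  by have := Dcov x; rewrite ffunE inE => /(_ isT).
move: ps => /andP[/existsP[h /existsP[k /and3P[_ Ph _]]] _].
by move: Ph (HP h); rewrite ffunE; lia.
Qed.

End Pebbling.

Theorem theorem7 (V : finType) (e : rel V) (P : V -> nat)
  (n : nat) (Hn : #|V| = n) (Hn2 : 2 <= n)
  (He : simple_graph e) (Hconn : connected_graph e)
  (HP : price_function P) :
  exists k : nat,
    is_pebbling_number e P (n - 1) k /\ is_pebbling_number e P n (k + 1).
Proof.
rewrite -Hn subn1; have V_gt0 : 0 < #|V| by lia.
have [[|k] [[solk mink] _]] := dec_inh_nat_subset_has_unique_least_element
  _ (fun k => classic (all_solvable e P #|V| k)) (all_solvable_card_ex P He Hconn).
  by case: (not_all_solvable0 HP V_gt0 solk).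
exists k; split; split.
- exact: all_solvable_cardP.
- by move=> k' /all_solvable_cardS/mink; lia.
- by rewrite addn1.
- by move=> k' /mink; lia.
Qed.
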